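(* Let $d\in(\sqrt3,2)$ and let $L\subset\mathbb{R}^2$ be the union of the closed unit discs with centres $(2dk,0)$, $k\in\mathbb{Z}$ (an equidistant string of unit circles with distance $2d$). Then the maximum density of packings of translates of $L$ in $\mathbb{R}^2$ is $$\frac{2\pi}{d\left(\sqrt{4-d^2}+d\sqrt3\right)} .$$ This density is attained for the following packing, consisting of translates $L_i$ ($i\in\mathbb{Z}$) of $L$, enumerated upwards. If $L_0$ has two neighbouring centres of circles $A_0,A_1$ with $|A_0A_1|=2d$, then $L_1$ lies above $L_0$ (its line of centres lies above that of $L_0$) and has a circle with centre $B_0$ such that $|A_0B_0|=|A_1B_0|=2$; $L_2$ lies above $L_1$ and has a circle with centre $C_1$ such that $|A_1C_1|=|B_0C_1|=2$; and the translation carrying $L_0$ to $L_2$ carries $L_i$ to $L_{i+2}$ for each integer $i$.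
   Context: A packing of translates of $L$ is a family of translates of $L$ with pairwise disjoint interiors. The density of a packing is meant in the usual sense: the (upper) limit, as $\rho\to\infty$, of the proportion of the area of the disc of radius $\rho$ about the origin covered by the members of the packing. $|XY|$ is the Euclidean distance of the points $X,Y$. ''Above'' refers to the $y$-coordinate. *)

(* Defs.v *)
From HB Require Import structures.
From mathcomp Require Import all_boot all_order all_algebra.
From mathcomp Require Import all_classical all_reals all_analysis.

Set Implicit Arguments.
Unset Strict Implicit.
Unset Printing Implicit Defensive.

Import Order.TTheory GRing.Theory Num.Theory.
Import numFieldNormedType.Exports.

Local Open Scope classical_set_scope.
Local Open Scope ring_scope.

Section Plane.
Context {R : realType}.

(* The library norm on R * R is the sup norm, so the Euclidean distance is
   spelled out; the topology of R * R is the usual one. *)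
Definition edist (p q : R * R) : R :=
  Num.sqrt ((p.1 - q.1) ^+ 2 + (p.2 - q.2) ^+ 2).

Definition disc (c : R * R) (r : R) : set (R * R) := [set p | edist p c <= r].

Definition area (A : set (R * R)) : \bar R :=
  (lebesgue_measure \x lebesgue_measure)%E A.

Definition translate (v : R * R) (A : set (R * R)) : set (R * R) :=
  [set p + v | p in A].

(* Members of a packing are indexed by an arbitrary type; disjointness of the
   interiors of members with distinct indices excludes repetitions as soon as
   the interior of A is nonempty. *)
Definition translate_packing (A : set (R * R)) (I : Type)
    (F : I -> set (R * R)) : Prop :=
  (forall i, exists v, F i = translate v A) /\
  trivIset [set: I] (fun i => interior (F i)).

(* For rho <= 0 the quotient is a junk value, irrelevant to the limit. *)
Definition upper_density (I : Type) (F : I -> set (R * R)) : \bar R :=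
  limf_esup
    (fun rho : R => area (disc 0%R rho `&` \bigcup_i F i) / area (disc 0%R rho))%E
    (pinfty_nbhs R).

Definition string_centres (d : R) : set (R * R) :=
  [set (2 * d * k%:~R, 0) | k in [set: int]].

Definition disc_string (d : R) : set (R * R) :=
  \bigcup_(c in string_centres d) disc c 1.

(* The packing L_i = disc_string d + t i; the line of centres of L_i is the
   horizontal line at height (t i).2.  The points A0, A1, B0, C1 are not
   determined by these conditions: A1 may lie on either side of A0, which
   yields two mirror-symmetric packings. *)
Definition two_step_packing (d : R) (t : int -> R * R) : Prop :=
  let L i := translate (t i) (disc_string d) in
  let centres i := translate (t i) (string_centres d) in
  [/\ forall i : int, (t i).2 < (t (i + 1)).2,
      exists A0 A1 B0 C1 : R * R,
        [/\ [/\ centres 0 A0, centres 0 A1 & edist A0 A1 = 2 * d],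
            [/\ centres 1 B0, edist A0 B0 = 2 & edist A1 B0 = 2] &
            [/\ centres 2 C1, edist A1 C1 = 2 & edist B0 C1 = 2]] &
      exists2 w, translate w (L 0) = L 2 &
        forall i : int, translate w (L i) = L (i + 2)].

End Plane.

(* Main.v *)
Require Import Defs.
From HB Require Import structures.
From mathcomp Require Import all_boot all_order all_algebra.
From mathcomp Require Import all_classical all_reals all_analysis.
From mathcomp Require Import measurable_realfun.
From mathcomp Require Import ring lra zify.

Set Implicit Arguments.
Unset Strict Implicit.
Unset Printing Implicit Defensive.

Import Order.TTheory GRing.Theory Num.Theory.
Import numFieldNormedType.Exports.

Local Open Scope classical_set_scope.
Local Open Scope ring_scope.

(** Write [h = gap d] for the least height difference of two strings of a
packing (attained when one lies halfway between the circles of the other) and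
[pitch d = (h + d sqrt 3) / 2].  The density claimed is
[pi / (d * pitch d)]: the discs of radius 1 have area [pi], and the centres
behave as if each of them owned half of a rectangle of width [2 d] and height
[pitch d].

The upper bound rests on a fact about three strings ([three_strings]): in a
packing, the lowest and the highest of three distinct strings differ in height
by at least [pitch d].  The heights at which one string can rest on another
are a periodic function of the horizontal offset, made of concave arcs.  So the
least height of a stack of three strings is reached when the middle string
lies halfway between the circles of the top or of the bottom one; that height
grows with the offset of the outer strings, while the height forced by these
two alone decreases, and the two curves cross at [pitch d].

Attach to every centre the cell [cell d (pitch d) c], a half-open rectangle of
width [2 d] and height [pitch d].  The cells of one string tile a horizontal
strip, so the fact above says that no point lies in three cells
([count_cell_le2]).  Comparing areas, the number of centres in a disc of radius
[r] times the area of a cell is at most twice the area of a slightly larger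
disc ([count_centres_le]).  In the two-step packing every point lies in two
cells ([two_rows_cover]), because the strings of even index and those of odd
index are both spaced by [pitch d]; this reverses the inequality
([le_count_centres]).  Passing from [r] to a radius that differs by a constant
does not change the limit of the quotients of areas ([density_le],
[le_density]).

It remains to see that the two-step packing is a packing.  Its defining
distances determine it up to reflection and periods ([two_step_two_rows]), and
the distances between its rows can then be computed ([row_dist]). *)

Local Notation edist := Defs.edist.

(** * Three strings on top of each other *)

(** Least height difference of two strings of a packing. *)
Definition gap (R : realType) (d : R) : R := Num.sqrt (4 - d ^+ 2).

(** Height difference of the strings of index [i] and [i + 2] in the two-step
packing. *)
Definition pitch (R : realType) (d : R) : R := (gap d + d * Num.sqrt 3) / 2.

Lemma gapP (R : realType) (d : R) : Num.sqrt 3 < d < 2 ->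
  [/\ 0 < gap d, 0 < Num.sqrt 3 :> R, gap d ^+ 2 + d ^+ 2 = 4
    & Num.sqrt 3 ^+ 2 = 3 :> R].
Proof.
move=> /andP[sd d2].
have s0 : 0 < Num.sqrt 3 :> R by rewrite sqrtr_gt0.
have d4 : 0 < 4 - d ^+ 2 by nra.
split=> //; first by rewrite sqrtr_gt0.
- by rewrite sqr_sqrtr ?ltW//; ring.
- by rewrite sqr_sqrtr.
Qed.

Lemma pitch_gt0 (R : realType) (d : R) : Num.sqrt 3 < d < 2 -> 0 < pitch d.
Proof.
move=> hd; have [h0 s0 _ _] := gapP hd; case/andP: hd => sd _.
by rewrite divr_gt0// addr_gt0// mulr_gt0// (lt_trans s0).
Qed.

Lemma le_of_sqr_le (R : realType) (x y : R) : 0 <= y -> x ^+ 2 <= y ^+ 2 -> x <= y.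
Proof. by move=> y0 xy; rewrite leNgt; apply/negP => yx; nra. Qed.

(** The chord from [(p1, q1)] to [(p2, q2)] stays in the disc of radius 2, so a
point above the axis and outside the open disc that shares its abscissa with a
point of the chord lies above that point. *)
Lemma chord_le (R : realType) (p1 q1 p2 q2 t y : R) :
  0 <= t <= 1 -> p1 ^+ 2 + q1 ^+ 2 <= 4 -> p2 ^+ 2 + q2 ^+ 2 <= 4 ->
  4 <= ((1 - t) * p1 + t * p2) ^+ 2 + y ^+ 2 -> 0 <= y ->
  (1 - t) * q1 + t * q2 <= y.
Proof.
move=> /andP[t0 t1] P Q A y0.
apply: le_of_sqr_le => //.
have t1' : 0 <= 1 - t by lra.
have e1 : 0 <= (1 - t) * (4 - (p1 ^+ 2 + q1 ^+ 2)) by apply: mulr_ge0 => //; lra.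
have e2 : 0 <= t * (4 - (p2 ^+ 2 + q2 ^+ 2)) by apply: mulr_ge0 => //; lra.
have e3 : 0 <= t * (1 - t) * ((p1 - p2) ^+ 2 + (q1 - q2) ^+ 2).
  by rewrite !mulr_ge0// addr_ge0// sqr_ge0.
lra.
Qed.

(** The two abscissas are symmetric in the interval, so the heights of the chord at
them add up to the sum of the heights at its ends. *)
Lemma two_chords_le (R : realType) (p1 q1 p2 q2 a b y z : R) :
  p1 < p2 -> p1 ^+ 2 + q1 ^+ 2 <= 4 -> p2 ^+ 2 + q2 ^+ 2 <= 4 ->
  p1 <= a <= p2 -> a + b = p1 + p2 ->
  4 <= a ^+ 2 + y ^+ 2 -> 4 <= b ^+ 2 + z ^+ 2 -> 0 <= y -> 0 <= z ->
  q1 + q2 <= y + z.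
Proof.
move=> p12 P Q /andP[pa ap] ab A B y0 z0.
pose t := (a - p1) / (p2 - p1).
have p0 : 0 < p2 - p1 by lra.
have tE : t * (p2 - p1) = a - p1 by rewrite /t divfK// gt_eqF.
have t01 : 0 <= t <= 1.
  by rewrite /t divr_ge0 ?ler_pdivrMr//=; lra.
have t01' : 0 <= 1 - t <= 1 by lra.
have aE : a = (1 - t) * p1 + t * p2 by lra.
have bE : b = (1 - (1 - t)) * p1 + (1 - t) * p2 by lra.
rewrite aE in A; rewrite bE in B.
have := chord_le t01 P Q A y0; have := chord_le t01' P Q B z0; lra.
Qed.

Lemma reduce_mod (R : realType) (d x : R) : 0 < d ->
  exists k : int, - d <= x + 2 * d * k%:~R < d.
Proof.
move=> d0; exists (- Num.floor ((x + d) / (2 * d))).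
have d2 : 0 < 2 * d by lra.
have /andP[] := floor_itv ((x + d) / (2 * d)).
rewrite ler_pdivlMr// ltr_pdivrMr// rmorphN/= intrD; set k := _%:~R; lra.
Qed.

(** Here [(x1, y1)] leads from the bottom string to the middle one and [(x2, y2)]
from the middle one to the top one; the hypotheses express that circles of
different strings do not overlap.  After a reflection the outer strings have
offset [x1 + x2] in [[0, d]].  If this offset is at most [(d - s h) / 2], the
circles of the outer strings already force the height.  Otherwise the
point [(x1 + x2 - d, (d s - h) / 2)] lies in the disc of radius 2, and
[two_chords_le] applies to the chord from it to [(d, h)]. *)
Lemma three_strings (R : realType) (d h s x1 y1 x2 y2 : R) :
  0 < h -> 0 < s -> s < d -> h ^+ 2 + d ^+ 2 = 4 -> s ^+ 2 = 3 ->
  0 <= y1 -> 0 <= y2 ->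
  (forall k : int, 4 <= (x1 + 2 * d * k%:~R) ^+ 2 + y1 ^+ 2) ->
  (forall k : int, 4 <= (x2 + 2 * d * k%:~R) ^+ 2 + y2 ^+ 2) ->
  (forall k : int, 4 <= (x1 + x2 + 2 * d * k%:~R) ^+ 2 + (y1 + y2) ^+ 2) ->
  (h + d * s) / 2 <= y1 + y2.
Proof.
move=> h0 s0 sd hd s3 y10 y20 A B C.
have d0 : 0 < d by lra.
have h1 : h < 1 by nra.
wlog x0 : x1 x2 A B C / 0 <= x1 + x2 <= d.
  move=> W.
  have [k /andP[k1 k2]] := reduce_mod (x1 + x2) d0.
  have [x0|x0] := leP 0 (x1 + x2 + 2 * d * k%:~R).
    apply: (W x1 (x2 + 2 * d * k%:~R)) => // [m|m|]; last lra.
      by have := B (k + m); rewrite intrD mulrDr addrA.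
    by have := C (k + m); rewrite intrD mulrDr !addrA.
  apply: (W (- x1) (- x2 - 2 * d * k%:~R)) => // [m|m|m|]; last lra.
  - by have := A (- m); rewrite rmorphN/=; set u := _%:~R => ?; nra.
  - have := B (k - m); rewrite intrD rmorphN/=; set u := k%:~R; set v := m%:~R.
    by move=> ?; nra.
  - have := C (k - m); rewrite intrD rmorphN/=; set u := k%:~R; set v := m%:~R.
    by move=> ?; nra.
wlog a0 : x1 x2 A B C x0 / - d <= x1 < d.
  move=> W; have [k /andP[k1 k2]] := reduce_mod x1 d0.
  apply: (W (x1 + 2 * d * k%:~R) (x2 - 2 * d * k%:~R)) => // [m|m|m||]; last 2 first.
  - by move: x0; set u := _%:~R; lra.
  - by rewrite k1 k2.
  - by have := A (k + m); rewrite intrD mulrDr addrA.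
  - by have := B (m - k); rewrite intrD rmorphN/= mulrDr mulrN addrAC addrA.
  - by have := C m; set u := _%:~R; set v := _%:~R => ?; nra.
set x := x1 + x2 in C x0.
have x00 : 0 < (d - s * h) / 2 by nra.
have [xs|xs] := leP x ((d - s * h) / 2).
  have := C 0; rewrite mulr0 addr0 => C0.
  apply: le_of_sqr_le; first lra.
  have : x ^+ 2 <= ((d - s * h) / 2) ^+ 2 by nra.
  suff : ((d - s * h) / 2) ^+ 2 + ((h + d * s) / 2) ^+ 2 = 4 by lra.
  have -> : ((d - s * h) / 2) ^+ 2 + ((h + d * s) / 2) ^+ 2 =
    (1 + s ^+ 2) * (h ^+ 2 + d ^+ 2) / 4 by field.
  rewrite s3 hd; lra.
have P : (x - d) ^+ 2 + ((d * s - h) / 2) ^+ 2 <= 4.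
  have : (d - x) ^+ 2 <= ((d + s * h) / 2) ^+ 2 by nra.
  have : ((d + s * h) / 2) ^+ 2 + ((d * s - h) / 2) ^+ 2 = 4.
    have -> : ((d + s * h) / 2) ^+ 2 + ((d * s - h) / 2) ^+ 2 =
      (1 + s ^+ 2) * (h ^+ 2 + d ^+ 2) / 4 by field.
    rewrite s3 hd; lra.
  have -> : (d - x) ^+ 2 = (x - d) ^+ 2 by ring.
  lra.
have Q : d ^+ 2 + h ^+ 2 <= 4 by rewrite addrC hd.
have := A 0; rewrite mulr0 addr0 => A0.
suff : (d * s - h) / 2 + h <= y1 + y2 by lra.
(* The offsets of the middle string from the bottom one and of the top string
   from the middle one, reduced modulo 2 d, both lie in [x - d, d] or, after a
   change of sign, both lie in [d - x, d]. *)
have [ax|ax] := leP (x - d) x1.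
  have := B 0; rewrite mulr0 addr0 => B0.
  by apply: (two_chords_le _ P Q _ _ A0 B0) => //; rewrite /x in x0 xs ax *; lra.
have P' : (d - x) ^+ 2 + ((d * s - h) / 2) ^+ 2 <= 4 by rewrite -sqrrN opprB.
have A0' : 4 <= (- x1) ^+ 2 + y1 ^+ 2 by rewrite sqrrN.
have B1 : 4 <= (2 * d - x2) ^+ 2 + y2 ^+ 2.
  by have := B (-1); rewrite rmorphN1 => ?; nra.
apply: (two_chords_le _ P' Q _ _ A0' B1) => //; rewrite /x in x0 xs ax *; lra.
Qed.

(** * The area of a disc *)

(** Outside the disc the square root of a negative number is 0, so that this is the
half-length of the chord at every abscissa. *)
Definition half_chord (R : realType) (r y : R) : R := Num.sqrt (r ^+ 2 - y ^+ 2).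

(** An antiderivative of the length of the chord.  The arcsine of [y / r] is
written as twice an arctangent, which is continuous up to the ends of the
diameter. *)
Definition segment_area (R : realType) (c r x : R) : R :=
  (x - c) * half_chord r (x - c)
  + 2 * r ^+ 2 * atan ((x - c) / (r + half_chord r (x - c))).

Lemma continuous_half_chord (R : realType) (c r : R) :
  continuous (fun x : R => half_chord r (x - c)).
Proof.
move=> x; apply: (@continuous_comp _ _ _ (fun x : R => r ^+ 2 - (x - c) ^+ 2)
  Num.sqrt); last exact: sqrt_continuous.
apply: cvgB; first exact: cvg_cst.
apply: (@continuous_comp _ _ _ (fun x : R => x - c) (fun x => x ^+ 2)) => //=.
  by apply: cvgB => //; exact: cvg_cst.
exact: exprn_continuous.
Qed.

Lemma continuous_segment_area (R : realType) (c r : R) : 0 < r ->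
  continuous (segment_area c r).
Proof.
move=> r0 x.
have cy : {for x, continuous (fun x : R => x - c)}.
  by apply: cvgB => //; exact: cvg_cst.
have cw := @continuous_half_chord R c r x.
apply: cvgD; first exact: cvgM.
apply: cvgM; first exact: cvg_cst.
apply: (@continuous_comp _ _ _
  (fun x : R => (x - c) / (r + half_chord r (x - c))) atan);
  last exact: continuous_atan.
apply: cvgM => //; apply: cvgV.
  by rewrite gt_eqF// ltr_wpDr// sqrtr_ge0.
by apply: cvgD => //; exact: cvg_cst.
Qed.

Lemma is_derive_segment_area (R : realType) (c r x : R) :
  0 < r -> - r < x - c < r ->
  is_derive x 1 (segment_area c r) (2 * half_chord r (x - c)).
Proof.
move=> r0 xr.
have y2 : 0 < r ^+ 2 - (x - c) ^+ 2 by nra.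
have dy : is_derive x 1 (fun x : R => x - c) 1.
  by apply: is_derive_eq; rewrite subr0.
pose g := fun x : R => r ^+ 2 - (x - c) ^+ 2.
pose w := fun x : R => half_chord r (x - c).
have w0 : 0 < w x by rewrite /w /half_chord sqrtr_gt0.
have w2 : w x ^+ 2 = r ^+ 2 - (x - c) ^+ 2 by rewrite sqr_sqrtr// ltW.
have dw : is_derive x 1 w (- (x - c) / w x).
  have ds := is_derive1_sqrt y2.
  have dg : is_derive x 1 g (- (2 * (x - c))).
    by apply: is_derive_eq; rewrite /GRing.scale/=; ring.
  have dc : is_derive x 1 w _ := @is_derive1_comp R Num.sqrt g x _ _ ds dg.
  apply: (is_derive_eq dc); rewrite -[Num.sqrt _]/(w x); field.
  by rewrite gt_eqF.
have rw0 : r + w x != 0 by rewrite gt_eqF// addr_gt0.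
have dv : is_derive x 1 (fun z => r + w z) (- (x - c) / w x).
  by apply: (is_derive_eq (is_deriveD (is_derive_cst r x 1) dw)); rewrite add0r.
have dV := @is_deriveV R (fun z => r + w z) x _ _ rw0 dv.
have dq := is_deriveM dy dV.
have da := is_derive1_comp (is_derive1_atan _) dq.
have ds : is_derive x 1 (segment_area c r) _ :=
  is_deriveD (is_deriveM dy dw) (is_deriveM (is_derive_cst (2 * r ^+ 2) x 1) da).
apply: (is_derive_eq ds).
rewrite /GRing.scale/= -[half_chord _ _]/(w x).
rewrite [(_ * _ : R -> R) x]/GRing.mul/=.
move: (x - c) (w x) rw0 w0 w2 {ds da dq dV dv dw dy y2 xr} => y W rw0 w0 w2.
have W0 : W != 0 by rewrite gt_eqF.
have r0' : r != 0 by rewrite gt_eqF.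
have y2 : y ^+ 2 = (r - W) * (r + W) by rewrite -subr_sqr w2; ring.
have -> : 1 + (y / (r + W)) ^+ 2 = 2 * r / (r + W).
  by rewrite expr_div_n y2; field.
have -> : y * (- (r + W) ^- 2 * (- y / W)) + (r + W)^-1 * 1 = r / (W * (r + W)).
  have -> : y * (- (r + W) ^- 2 * (- y / W)) = y ^+ 2 / ((r + W) ^+ 2 * W).
    by field; rewrite ?rw0 ?W0.
  by rewrite y2; field; rewrite ?rw0 ?W0.
have -> : y * (- y / W) = - y ^+ 2 / W by ring.
by rewrite y2; field; rewrite ?rw0 ?W0 ?r0'.
Qed.

Lemma integral_half_chord (R : realType) (c r : R) : 0 < r ->
  (\int[lebesgue_measure]_x (2 * half_chord r (x - c))%:E = (pi * r ^+ 2)%:E)%E.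
Proof.
move=> r0.
have out x : ~~ (- r < x - c < r) -> half_chord r (x - c) = 0.
  move=> xr; rewrite /half_chord ler0_sqrtr//.
  by move: xr; rewrite negb_and -!leNgt => /orP[] ?; nra.
transitivity (\int[lebesgue_measure]_(x in `[(c - r)%R, (c + r)%R])
    (2 * half_chord r (x - c))%:E)%E.
  rewrite [RHS]integral_mkcond; apply: eq_integral => x _.
  rewrite patchE; case: ifPn => // xr; rewrite out ?mulr0//.
  apply: contraNN xr => /andP[xr1 xr2]; rewrite inE/= in_itv/=.
  by apply/andP; split; lra.
rewrite (@continuous_FTC2 _ _ (segment_area c r)).
- rewrite -EFinD /segment_area.
  have -> : c + r - c = r by ring.
  have -> : c - r - c = - r by ring.
  rewrite /half_chord sqrrN subrr sqrtr0 !mulr0 !addr0 mulNr divff ?gt_eqF//.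
  by rewrite atanN atan1; congr (_%:E); lra.
- by lra.
- apply: continuous_subspaceT => x; apply: cvgM; first exact: cvg_cst.
  exact: continuous_half_chord.
- split.
  + move=> x; rewrite in_itv/= => /andP[x1 x2].
    by apply: (@ex_derive _ _ _ _ _ _ _ (@is_derive_segment_area R c r x r0 _)); lra.
  + apply: cvg_at_right_filter; exact: continuous_segment_area.
  + apply: cvg_at_left_filter; exact: continuous_segment_area.
- move=> x; rewrite in_itv/= => /andP[x1 x2].
  rewrite derive1E.
  by apply: (@derive_val _ _ _ _ _ _ _ (@is_derive_segment_area R c r x r0 _)); lra.
Qed.

Lemma edist_le (R : realType) (p c : R * R) (r : R) : 0 <= r ->
  (edist p c <= r) = ((p.1 - c.1) ^+ 2 + (p.2 - c.2) ^+ 2 <= r ^+ 2).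
Proof.
move=> r0; rewrite /edist -[in LHS](ger0_norm r0) -sqrtr_sqr ler_sqrt//.
exact: sqr_ge0.
Qed.

Lemma edist_lt (R : realType) (p c : R * R) (r : R) : 0 < r ->
  (edist p c < r) = ((p.1 - c.1) ^+ 2 + (p.2 - c.2) ^+ 2 < r ^+ 2).
Proof.
move=> r0; rewrite /edist -[in LHS](gtr0_norm r0) -sqrtr_sqr ltr_sqrt//.
exact: exprn_gt0.
Qed.

Definition open_disc (R : realType) (c : R * R) (r : R) : set (R * R) :=
  [set p | edist p c < r].

Lemma half_chord_sqr (R : realType) (r y : R) :
  - r <= y <= r -> half_chord r y ^+ 2 = r ^+ 2 - y ^+ 2.
Proof. by move=> yr; rewrite sqr_sqrtr//; nra. Qed.

Lemma area_disc (R : realType) (c : R * R) (r : R) : 0 < r ->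
  area (disc c r) = (pi * r ^+ 2)%:E.
Proof.
move=> r0; rewrite /area /product_measure1 -(integral_half_chord c.1 r0).
apply: eq_integral => x _ /=.
have [xr|xr] := boolP (- r <= x - c.1 <= r).
  have w0 : 0 <= half_chord r (x - c.1) := sqrtr_ge0 _.
  have w2 := half_chord_sqr xr.
  set w := half_chord _ _ in w0 w2 *.
  rewrite (_ : xsection _ _ = `[c.2 - w, c.2 + w]%classic).
    rewrite lebesgue_measure_itv/= lte_fin; case: ifPn => [_|].
      by rewrite -EFinD; congr (_%:E); ring.
    by rewrite -leNgt => ?; congr (_%:E); lra.
  apply/seteqP; split=> y; rewrite /xsection/= in_itv/= inE /disc/= (edist_le _ _ (ltW r0))/=;
    move=> H; nra.
rewrite (_ : xsection _ _ = set0).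
  rewrite measure0 /half_chord ler0_sqrtr ?mulr0//.
  by move: xr; rewrite negb_and -!ltNge => /orP[] ?; nra.
rewrite -subset0 => y; rewrite /xsection/= inE /disc/= (edist_le _ _ (ltW r0))/= => H.
have y0 := sqr_ge0 (y - c.2).
by move: xr; rewrite negb_and -!ltNge => /orP[] ?; nra.
Qed.

(** Closed discs of a packing may touch; bounding a covered area from below needs the
disjoint open ones. *)
Lemma area_open_disc (R : realType) (c : R * R) (r : R) : 0 < r ->
  area (open_disc c r) = (pi * r ^+ 2)%:E.
Proof.
move=> r0; rewrite /area /product_measure1 -(integral_half_chord c.1 r0).
apply: eq_integral => x _ /=.
have [xr|xr] := boolP (- r < x - c.1 < r).
  have w0 : 0 <= half_chord r (x - c.1) := sqrtr_ge0 _.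
  have w2 : half_chord r (x - c.1) ^+ 2 = r ^+ 2 - (x - c.1) ^+ 2.
    by apply: half_chord_sqr; lra.
  set w := half_chord _ _ in w0 w2 *.
  rewrite (_ : xsection _ _ = `]c.2 - w, c.2 + w[%classic).
    rewrite lebesgue_measure_itv/= lte_fin; case: ifPn => [_|].
      by rewrite -EFinD; congr (_%:E); ring.
    by rewrite -leNgt => ?; congr (_%:E); lra.
  apply/seteqP; split=> y; rewrite /xsection/= in_itv/= inE /open_disc/= (edist_lt _ _ r0)/=;
    move=> H; nra.
rewrite (_ : xsection _ _ = set0).
  rewrite measure0 /half_chord ler0_sqrtr ?mulr0//.
  by move: xr; rewrite negb_and -!leNgt => /orP[] ?; nra.
rewrite -subset0 => y; rewrite /xsection/= inE /open_disc/= (edist_lt _ _ r0)/= => H.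
have y0 := sqr_ge0 (y - c.2).
by move: xr; rewrite negb_and -!leNgt => /orP[] ?; nra.
Qed.

(** * Comparing measures by counting with multiplicity *)

Lemma measurable_sqr_dist (R : realType) (c : R * R) :
  measurable_fun setT (fun p : measurableTypeR R * measurableTypeR R =>
    ((p.1 - c.1) ^+ 2 + (p.2 - c.2) ^+ 2 : R)).
Proof.
by apply: measurable_funD; apply: measurable_funX; apply: measurable_funB.
Qed.

Lemma measurable_disc (R : realType) (c : R * R) (r : R) : 0 <= r ->
  measurable (disc c r : set (measurableTypeR R * measurableTypeR R)).
Proof.
move=> r0.
have := measurable_sqr_dist c measurableT (measurable_itv `]-oo, (r ^+ 2)]).
rewrite setTI; congr measurable; apply/seteqP; split=> p /=;
  by rewrite in_itv/= /disc/= edist_le.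
Qed.

Lemma measurable_open_disc (R : realType) (c : R * R) (r : R) : 0 < r ->
  measurable (open_disc c r : set (measurableTypeR R * measurableTypeR R)).
Proof.
move=> r0.
have := measurable_sqr_dist c measurableT (measurable_itv `]-oo, (r ^+ 2)[).
rewrite setTI; congr measurable; apply/seteqP; split=> p /=;
  by rewrite in_itv/= /open_disc/= edist_lt.
Qed.

Lemma sum_measureE (d : measure_display) (T : measurableType d) (R : realType)
    (mu : {measure set T -> \bar R}) (I : Type) (s : seq I) (A : I -> set T) :
  (forall i, measurable (A i)) ->
  (\sum_(i <- s) mu (A i) = \int[mu]_x (count (fun i => x \in A i) s)%:R%:E)%E.
Proof.
move=> mA.
transitivity (\sum_(i <- s) \int[mu]_x (\1_(A i) x)%:E)%E.
  by apply: eq_bigr => i _; rewrite integral_indic// setIT.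
rewrite -ge0_integral_sum//.
- apply: eq_integral => x _; rewrite sumEFin; congr (_%:E).
  by elim: s => [|i s IH]; rewrite ?big_nil// big_cons/= IH natrD indicE.
- by move=> i; apply/measurable_EFinP; exact: measurable_indic.
Qed.

(** Both sums are integrals of multiplicities of covering. *)
Lemma sum_measure_le (d : measure_display) (T : measurableType d) (R : realType)
    (mu : {measure set T -> \bar R}) (I J : Type) (s : seq I) (t : seq J)
    (A : I -> set T) (B : J -> set T) :
  (forall i, measurable (A i)) -> (forall j, measurable (B j)) ->
  (forall x, (count (fun i => x \in A i) s <= count (fun j => x \in B j) t)%N) ->
  (\sum_(i <- s) mu (A i) <= \sum_(j <- t) mu (B j))%E.
Proof.
have mc K (r : seq K) (C : K -> set T) : (forall k, measurable (C k)) ->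
    measurable_fun setT (fun x => (count (fun k => x \in C k) r)%:R%:E : \bar R).
  move=> mC; apply/measurable_EFinP.
  rewrite (_ : (fun _ => _) = (fun x => \sum_(k <- r) \1_(C k) x)).
    by apply: measurable_sum => k; exact: measurable_indic.
  apply/funext => x; elim: r => [|k r IH]; rewrite ?big_nil// big_cons/= -IH.
  by rewrite natrD indicE.
move=> mA mB AB; rewrite !sum_measureE//; apply: ge0_le_integral => //.
- exact: mc.
- exact: mc.
- by move=> x _; rewrite lee_fin ler_nat.
Qed.

(** Half-open, so that the cells of one string tile a strip exactly. *)
Definition cell (R : realType) (d H : R) (c : R * R) : set (R * R) :=
  `[c.1 - d, c.1 + d[%classic `*` `[c.2, c.2 + H[%classic.

Lemma measurable_cell (R : realType) (d H : R) (c : R * R) :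
  measurable (cell d H c : set (measurableTypeR R * measurableTypeR R)).
Proof. by apply: measurableX; exact: measurable_itv. Qed.

Lemma area_cell (R : realType) (d H : R) (c : R * R) : 0 < d -> 0 < H ->
  area (cell d H c) = (2 * d * H)%:E.
Proof.
move=> d0 H0.
have -> : area (cell d H c) =
    (lebesgue_measure (`[(c.1 - d)%R, (c.1 + d)%R[%classic : set R)
     * lebesgue_measure (`[c.2, (c.2 + H)%R[%classic : set R))%E.
  by apply: product_measure1E; exact: measurable_itv.
rewrite !lebesgue_measure_itv/= !lte_fin !ifT; [|lra..].
by rewrite -!EFinD -EFinM; congr (_%:E); ring.
Qed.

(** * Counting the centres in a disc *)

Lemma edist_triangle (R : realType) (p q o : R * R) (a b : R) :
  0 <= a -> 0 <= b -> edist p q <= a -> edist q o <= b -> edist p o <= a + b.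
Proof.
move=> a0 b0; rewrite !edist_le ?addr_ge0// => pq qo.
have -> : p.1 - o.1 = (p.1 - q.1) + (q.1 - o.1) by ring.
have -> : p.2 - o.2 = (p.2 - q.2) + (q.2 - o.2) by ring.
move: (p.1 - q.1) (p.2 - q.2) (q.1 - o.1) (q.2 - o.2) pq qo => x y z t xy zt.
suff : x * z + y * t <= a * b by lra.
apply: le_of_sqr_le; first exact: mulr_ge0.
have -> : (a * b) ^+ 2 = a ^+ 2 * b ^+ 2 by ring.
have : (x ^+ 2 + y ^+ 2) * (z ^+ 2 + t ^+ 2) <= a ^+ 2 * b ^+ 2.
  by apply: ler_pM => //; rewrite addr_ge0// sqr_ge0.
have := sqr_ge0 (x * t - y * z).
lra.
Qed.

(** The only properties of the centres of a packing of strings that matter for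
counting: they are periodic, and two of them belong to the same string or are
at distance at least 2. *)
Definition centre_set (R : realType) (d : R) (C : set (R * R)) : Prop :=
  (forall c, C c -> forall k : int, C (c.1 + 2 * d * k%:~R, c.2)) /\
  (forall c c', C c -> C c' ->
    (exists k : int, c' = (c.1 + 2 * d * k%:~R, c.2)) \/
    4 <= (c'.1 - c.1) ^+ 2 + (c'.2 - c.2) ^+ 2).

(** Two centres of one string never share a point of their cells. *)
Lemma centre_set_cell (R : realType) (d H : R) (C : set (R * R)) (c c' p : R * R) :
  0 < d -> centre_set d C -> C c -> C c' -> c != c' ->
  cell d H c p -> cell d H c' p ->
  forall k : int, 4 <= (c'.1 - c.1 + 2 * d * k%:~R) ^+ 2 + (c'.2 - c.2) ^+ 2.
Proof.
move=> d0 [C1 C2] Cc Cc' cc' [/= + _] [/= + _] k.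
rewrite !in_itv/= => /andP[a1 a2] /andP[b1 b2].
have [[m]|] := C2 _ _ Cc (C1 _ Cc' k); last first.
  by rewrite /= [_ + _ - c.1]addrAC.
case=> e1 e2; exfalso.
have e3 : c'.1 - c.1 = 2 * d * (m - k)%:~R by rewrite intrB mulrBr; lra.
have [mk|mk] := eqVneq (m - k) 0.
  case/eqP: cc'; rewrite [c]surjective_pairing [c']surjective_pairing e2.
  by congr pair; move: e3; rewrite mk mulr0; lra.
have : 2 * d <= `|c'.1 - c.1|.
  rewrite e3 normrM gtr0_norm; last lra.
  apply: ler_peMr; first lra.
  by rewrite -intr_norm -[1]/(1%:~R) ler_int -gtz0_ge1 normr_gt0.
have : `|c'.1 - c.1| < 2 * d by rewrite ltr_norml; lra.
by move=> /lt_le_trans h /h; rewrite ltxx.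
Qed.

(** If three cells meet, their centres belong to different strings and their
heights differ by less than the height of a cell. *)
Lemma three_cells (R : realType) (d : R) (C : set (R * R)) (c1 c2 c3 p : R * R) :
  Num.sqrt 3 < d < 2 ->
  centre_set d C -> C c1 -> C c2 -> C c3 -> c1 != c2 -> c1 != c3 -> c2 != c3 ->
  cell d (pitch d) c1 p -> cell d (pitch d) c2 p -> cell d (pitch d) c3 p -> False.
Proof.
move=> hd CC Cc1 Cc2 Cc3 c12 c13 c23.
have [h0 s0 hd4 s3] := gapP hd.
case/andP: hd => sd _.
have d0 : 0 < d := lt_trans s0 sd.
wlog c12' : c1 c2 c3 Cc1 Cc2 Cc3 c12 c13 c23 / c1.2 <= c2.2.
  move=> W p1 p2 p3; have [l|/ltW l] := leP c1.2 c2.2.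
    exact: (W c1 c2 c3).
  by apply: (W c2 c1 c3) => //; rewrite eq_sym.
wlog c23' : c1 c2 c3 Cc1 Cc2 Cc3 c12 c13 c23 c12' / c2.2 <= c3.2.
  move=> W p1 p2 p3; have [l|/ltW l] := leP c2.2 c3.2.
    exact: (W c1 c2 c3).
  have [l'|/ltW l'] := leP c1.2 c3.2.
    by apply: (W c1 c3 c2) => //; rewrite eq_sym.
  by apply: (W c3 c1 c2) => //; rewrite eq_sym.
move=> p1 p2 p3.
have A := centre_set_cell d0 CC Cc1 Cc2 c12 p1 p2.
have B := centre_set_cell d0 CC Cc2 Cc3 c23 p2 p3.
have D := centre_set_cell d0 CC Cc1 Cc3 c13 p1 p3.
have : pitch d <= (c2.2 - c1.2) + (c3.2 - c2.2).
  apply: (three_strings h0 s0 sd hd4 s3 _ _ A B); rewrite ?subr_ge0// => k.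
  have -> : c2.1 - c1.1 + (c3.1 - c2.1) = c3.1 - c1.1 by ring.
  by have -> : c2.2 - c1.2 + (c3.2 - c2.2) = c3.2 - c1.2 by ring.
move: p1 p3 => [_ /=] + [_ /=]; rewrite !in_itv/=; lra.
Qed.

Lemma count_cell_le2 (R : realType) (d : R) (C : set (R * R)) (p : R * R)
    (r : seq (R * R)) :
  Num.sqrt 3 < d < 2 ->
  centre_set d C -> uniq r -> {in r, forall c, C c} ->
  (count (fun c => p \in cell d (pitch d) c) r <= 2)%N.
Proof.
move=> hd CC ur rC.
rewrite -size_filter.
have := filter_uniq (fun c => p \in cell d (pitch d) c) ur.
have : {in [seq c <- r | p \in cell d (pitch d) c],
    forall c, C c /\ cell d (pitch d) c p}.
  by move=> c; rewrite mem_filter => /andP[pc /rC Cc]; split=> //; rewrite inE in pc.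
case: [seq _ <- _ | _] => [//|c1 [//|c2 [//|c3 r']]] rr.
rewrite /= !inE !negb_or => /and4P[/and3P[c12 c13 _] /andP[c23 _] _ _].
have [] := rr c1; first by rewrite !inE eqxx.
have [] := rr c2; first by rewrite !inE eqxx ?orbT.
have [] := rr c3; first by rewrite !inE eqxx ?orbT.
move=> C3 p3 C2 p2 C1 p1.
by case: (three_cells hd CC C1 C2 C3 c12 c13 c23 p1 p2 p3).
Qed.

Lemma edist_cell (R : realType) (d H : R) (c p : R * R) : 0 < d -> 0 < H ->
  cell d H c p -> edist p c <= d + H.
Proof.
move=> d0 H0 [/=]; rewrite !in_itv/= => /andP[a1 a2] /andP[b1 b2].
rewrite edist_le; last lra.
have : (p.1 - c.1) ^+ 2 <= d ^+ 2 by nra.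
have : (p.2 - c.2) ^+ 2 <= H ^+ 2 by nra.
nra.
Qed.

Lemma edistC (R : realType) (p q : R * R) : edist p q = edist q p.
Proof. by rewrite /edist -sqrrN opprB -[X in _ + X]sqrrN opprB. Qed.

Lemma sum_area_cells (R : realType) (d H : R) (r : seq (R * R)) :
  0 < d -> 0 < H ->
  (\sum_(c <- r) area (cell d H c) = ((size r)%:R * (2 * d * H))%:E)%E.
Proof.
move=> d0 H0; elim: r => [|c r IH]; first by rewrite big_nil mul0r.
by rewrite big_cons IH area_cell// -EFinD /= -natr1; congr (_%:E); ring.
Qed.

(** The cells of the centres in the disc of radius [r] lie in the larger disc. *)
Lemma count_centres_le (R : realType) (d r : R) (C : set (R * R))
    (S : seq (R * R)) :
  Num.sqrt 3 < d < 2 -> 0 <= r ->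
  centre_set d C -> uniq S -> {in S, forall c, C c /\ disc 0 r c} ->
  (size S)%:R * (2 * d * pitch d) <= 2 * (pi * (r + (d + pitch d)) ^+ 2).
Proof.
move=> hd r0 CC uS SC.
have H0 := pitch_gt0 hd; set H := pitch d in H0 *.
have d0 : 0 < d by case/andP: hd => sd _; apply: le_lt_trans sd; exact: sqrtr_ge0.
rewrite -lee_fin -sum_area_cells//.
pose D := disc (0 : R * R) (r + (d + H)).
have -> : (2 * (pi * (r + (d + H)) ^+ 2))%:E = (\sum_(i <- [:: tt; tt]) area D)%E.
  rewrite !big_cons big_nil area_disc; last by rewrite ltr_wpDl// addr_gt0.
  by rewrite adde0 -EFinD; congr (_%:E); ring.
have mD : measurable (D : set (measurableTypeR R * measurableTypeR R)).
  by apply: measurable_disc; rewrite !addr_ge0// ltW.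
apply: (@sum_measure_le _ _ _ (lebesgue_measure \x lebesgue_measure)%E _ _ S
  [:: tt; tt] (cell d H) (fun=> D)) => [||x]; [exact: measurable_cell|by []|].
have [xD|xD] := boolP (x \in D).
  by rewrite count_predT (count_cell_le2 x hd CC uS)// => c /SC[].
rewrite (eq_in_count (a2 := pred0)) ?count_pred0// => c /SC[_ cr].
apply/negbTE; apply: contra xD; rewrite !inE => xc.
rewrite /D /disc/= [r + _]addrC; apply: (edist_triangle _ r0 (edist_cell d0 H0 xc) cr).
by rewrite addr_ge0// ltW.
Qed.

(** The cells that meet the smaller disc have their centres in the disc of radius
[r]. *)
Lemma le_count_centres (R : realType) (d r : R) (C : set (R * R))
    (S : seq (R * R)) :
  Num.sqrt 3 < d < 2 -> d + pitch d < r ->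
  (forall p, exists c c', [/\ C c, C c', c != c', cell d (pitch d) c p
     & cell d (pitch d) c' p]) ->
  uniq S -> (forall c, C c -> disc 0 r c -> c \in S) ->
  2 * (pi * (r - (d + pitch d)) ^+ 2) <= (size S)%:R * (2 * d * pitch d).
Proof.
move=> hd Kr CC uS SC.
have H0 := pitch_gt0 hd; set H := pitch d in H0 Kr CC *.
have d0 : 0 < d by case/andP: hd => sd _; apply: le_lt_trans sd; exact: sqrtr_ge0.
rewrite -lee_fin -sum_area_cells//.
pose D := disc (0 : R * R) (r - (d + H)).
have -> : (2 * (pi * (r - (d + H)) ^+ 2))%:E = (\sum_(i <- [:: tt; tt]) area D)%E.
  rewrite !big_cons big_nil area_disc; last by rewrite subr_gt0.
  by rewrite adde0 -EFinD; congr (_%:E); ring.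
have mD : measurable (D : set (measurableTypeR R * measurableTypeR R)).
  by apply: measurable_disc; rewrite subr_ge0 ltW.
apply: (@sum_measure_le _ _ _ (lebesgue_measure \x lebesgue_measure)%E _ _
  [:: tt; tt] S (fun=> D) (cell d H)) => [||x]; [by []|exact: measurable_cell|].
have [xD|xD] := boolP (x \in D); last by rewrite count_pred0.
rewrite count_predT -size_filter.
have [c [c' [Cc Cc' cc' xc xc']]] := CC x.
have inS b : C b -> cell d H b x -> b \in [seq c <- S | x \in cell d H c].
  move=> Cb xb; rewrite mem_filter mem_set//=; apply: SC => //.
  rewrite -[r](subrKC (d + H)) /disc/=.
  apply: (@edist_triangle _ _ x).
  - by rewrite addr_ge0// ltW.
  - by rewrite subr_ge0 ltW.
  - by rewrite edistC edist_cell.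
  - by rewrite inE in xD.
apply: (@uniq_leq_size _ [:: c; c']); first by rewrite /= inE cc'.
by move=> b; rewrite !inE => /orP[] /eqP ->; exact: inS.
Qed.

(** The bound on the number of centres applies to every finite subset. *)
Lemma finite_centres (R : realType) (d r : R) (C : set (R * R)) :
  Num.sqrt 3 < d < 2 -> 0 <= r -> centre_set d C ->
  finite_set (C `&` disc 0 r).
Proof.
move=> hd r0 CC; apply: contrapT => inf.
have H0 := pitch_gt0 hd.
have d0 : 0 < d by case/andP: hd => sd _; apply: le_lt_trans sd; exact: sqrtr_ge0.
have dH0 : 0 < 2 * d * pitch d by apply: mulr_gt0 => //; apply: mulr_gt0.
pose b := 2 * (pi * (r + (d + pitch d)) ^+ 2) / (2 * d * pitch d).
have [X XC Xn] := infinite_set_fset (Num.truncn b).+1 inf.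
have := count_centres_le hd r0 CC (finmap.fset_uniq X) (fun c cX => XC c cX).
rewrite -ler_pdivlMr// -/b => /le_lt_trans/(_ (truncnS_gt _)).
by rewrite ltr_nat ltnS leqNgt Xn.
Qed.

(** * Upper densities *)

Lemma limf_esup_le (R : realType) (T : choiceType) (X : filteredType T)
    (f : X -> \bar R) (F : set_system X) (l : \bar R) :
  (\forall x \near F, f x <= l)%E -> (limf_esup f F <= l)%E.
Proof.
move=> fl; rewrite limf_esupE; apply: (@le_trans _ _ (ereal_sup (f @` [set x | f x <= l]%E))).
  by apply: ereal_inf_lbound; exists [set x | f x <= l]%E.
by apply: ge_ereal_sup => _ [x xl <-].
Qed.

Lemma le_limf_esup (R : realType) (T : choiceType) (X : filteredType T)
    (f : X -> \bar R) (F : set_system X) (l : \bar R) : ProperFilter F ->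
  (\forall x \near F, l <= f x)%E -> (l <= limf_esup f F)%E.
Proof.
move=> PF fl; rewrite limf_esupE; apply: le_ereal_inf_tmp => _ [V FV <-].
have [x [Vx lx]] := filter_ex (filterI FV fl).
by apply: (le_trans lx); apply: ereal_sup_ubound; exists x.
Qed.

(** Enlarging or shrinking a large disc by a constant does not change its area much. *)
Lemma near_scale_sqr (R : realType) (l k e : R) : 0 < e ->
  \forall rho \near +oo%R,
    l - e <= l * ((rho + k) / rho) ^+ 2 <= l + e.
Proof.
move=> e0.
have cv : (fun rho : R => l * (1 + k * rho^-1) ^+ 2) @ +oo%R --> l.
  have -> : l = l * (1 + k * 0) ^+ 2 by rewrite mulr0 addr0 expr1n mulr1.
  apply: cvgM; first by rewrite mulr0 addr0 expr1n mulr1; exact: cvg_cst.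
  apply: (@cvg_comp _ _ _ (fun rho : R => 1 + k * rho^-1) (fun x => x ^+ 2) _
    (nbhs (1 + k * 0))); last exact: exprn_continuous.
  apply: cvgD; first exact: cvg_cst.
  apply: cvgM; first exact: cvg_cst.
  apply/(@gtr0_cvgV0 _ _ _ _ id) => //.
  by apply: nbhs_pinfty_gt; exact: num_real.
move/cvgrPdist_le/(_ e e0) : cv => near_e; near=> rho.
have rho0 : 0 < rho by near: rho; apply: nbhs_pinfty_gt; exact: num_real.
have -> : (rho + k) / rho = 1 + k * rho^-1 by field; rewrite gt_eqF.
have : `|l - l * (1 + k * rho^-1) ^+ 2| <= e by near: rho.
by rewrite ler_norml; set u := l * _; lra.
Unshelve. all: by end_near. Qed.

Definition covered (R : realType) (r : R) (C : set (R * R)) : set (R * R) :=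
  disc 0 r `&` \bigcup_(c in C) disc c 1.

Lemma enum_centres (R : realType) (d r : R) (C : set (R * R)) :
  Num.sqrt 3 < d < 2 -> 0 <= r -> centre_set d C ->
  exists2 S : seq (R * R), uniq S & forall c, (c \in S) <-> C c /\ disc 0 r c.
Proof.
move=> hd r0 CC; have /finite_seqP[S SE] := finite_centres hd r0 CC.
exists (undup S); first exact: undup_uniq.
by move=> c; rewrite mem_undup; move/seteqP: SE => [SE1 SE2]; split=> [/SE2|/SE1].
Qed.

Lemma coveredE (R : realType) (r : R) (C : set (R * R)) (S : seq (R * R)) :
  0 <= r -> (forall c, (c \in S) <-> C c /\ disc 0 (r + 1) c) ->
  covered r C = disc 0 r `&` \bigcup_(c in [set` S]) disc c 1.
Proof.
move=> r0 SE; apply/seteqP; split=> p [pr [c Cc pc]]; split=> //; exists c => //=.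
  apply/SE; split=> //; rewrite /disc/= addrC.
  by apply: (@edist_triangle _ _ p) => //; rewrite edistC.
by have /SE[] : c \in S by [].
Qed.

Lemma measurable_covered (R : realType) (d r : R) (C : set (R * R)) :
  Num.sqrt 3 < d < 2 -> 0 <= r -> centre_set d C ->
  measurable (covered r C : set (measurableTypeR R * measurableTypeR R)).
Proof.
move=> hd r0 CC.
have [S _ SE] := enum_centres hd (addr_ge0 r0 ler01) CC.
rewrite (coveredE r0 SE); apply: measurableI; first exact: measurable_disc.
apply: fin_bigcup_measurable => [|c _]; first exact: finite_seq.
exact: measurable_disc.
Qed.

Lemma sum_area_discs (R : realType) (S : seq (R * R)) :
  (\sum_(c <- S) area (disc c 1) = ((size S)%:R * pi)%:E)%E.
Proof.
elim: S => [|c S IH]; first by rewrite big_nil mul0r.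
rewrite big_cons IH area_disc// -EFinD /= -natr1 expr1n.
by congr (_%:E); ring.
Qed.

Lemma sum_area_open_discs (R : realType) (S : seq (R * R)) :
  (\sum_(c <- S) area (open_disc c 1) = ((size S)%:R * pi)%:E)%E.
Proof.
elim: S => [|c S IH]; first by rewrite big_nil mul0r.
rewrite big_cons IH area_open_disc// -EFinD /= -natr1 expr1n.
by congr (_%:E); ring.
Qed.

Lemma area_covered_le (R : realType) (d r : R) (C : set (R * R)) :
  Num.sqrt 3 < d < 2 -> 0 <= r -> centre_set d C ->
  (area (covered r C) <=
   (pi / (d * pitch d) * (pi * (r + (1 + (d + pitch d))) ^+ 2))%:E)%E.
Proof.
move=> hd r0 CC.
have H0 := pitch_gt0 hd.
have d0 : 0 < d by case/andP: hd => sd _; apply: le_lt_trans sd; exact: sqrtr_ge0.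
have r1 : 0 <= r + 1 by rewrite addr_ge0.
have [S uS SE] := enum_centres hd r1 CC.
have := count_centres_le hd r1 CC uS (fun c cS => (SE c).1 cS).
rewrite -addrA => N.
have A : (area (covered r C) <= \sum_(c <- S) area (disc c 1))%E.
  have -> : area (covered r C) = (\sum_(i <- [:: tt]) area (covered r C))%E.
    by rewrite big_seq1.
  apply: (@sum_measure_le _ _ _ (lebesgue_measure \x lebesgue_measure)%E _ _
    [:: tt] S (fun=> covered r C) (fun c => disc c 1)) => [_|c|x].
  - exact: measurable_covered CC.
  - exact: measurable_disc.
  rewrite /= addn0; have [|//] := boolP (x \in _).
  rewrite inE (coveredE r0 SE) => -[_ [c cS xc]].
  rewrite -has_count; apply/hasP; exists c => //; exact: mem_set.
apply: (le_trans A); rewrite sum_area_discs lee_fin.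
rewrite (_ : pi / _ * _ = pi * (2 * (pi * (r + (1 + (d + pitch d))) ^+ 2)
  / (2 * d * pitch d))).
  rewrite mulrC ler_pM2l ?pi_gt0// ler_pdivlMr// mulr_gt0// mulr_gt0//.
by field; rewrite !gt_eqF.
Qed.

Lemma centre_set_dist (R : realType) (d : R) (C : set (R * R)) (c c' : R * R) :
  1 <= d -> centre_set d C -> C c -> C c' -> c != c' ->
  4 <= (c'.1 - c.1) ^+ 2 + (c'.2 - c.2) ^+ 2.
Proof.
move=> d1 [_ CC] Cc Cc' cc'; have [[k kE]|//] := CC _ _ Cc Cc'.
have [k0|k0] := eqVneq k 0.
  by case/eqP: cc'; rewrite kE k0 mulr0 addr0 -surjective_pairing.
have k1 : 1 <= (k%:~R : R) ^+ 2.
  rewrite -[_ ^+ 2]ger0_norm ?sqr_ge0// normrX -intr_norm.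
  rewrite exprn_ege1// -[1]/(1%:~R) ler_int -gtz0_ge1 normr_gt0//.
rewrite kE/= subrr expr0n/= addr0 addrAC subrr add0r.
set u := k%:~R in k1 *; nra.
Qed.

Lemma le_area_covered (R : realType) (d r : R) (C : set (R * R)) :
  Num.sqrt 3 < d < 2 -> 1 + (d + pitch d) < r -> centre_set d C ->
  (forall p, exists c c', [/\ C c, C c', c != c', cell d (pitch d) c p
     & cell d (pitch d) c' p]) ->
  ((pi / (d * pitch d) * (pi * (r - (1 + (d + pitch d))) ^+ 2))%:E <=
    area (covered r C))%E.
Proof.
move=> hd Kr CC dbl.
have H0 := pitch_gt0 hd.
have [_ s0 _ s3] := gapP hd.
have d1 : 1 <= d by case/andP: hd => sd _; nra.
have d0 : 0 < d by lra.
have r1 : 0 <= r - 1 by lra.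
have r0 : 0 <= r by lra.
have [S uS SE] := enum_centres hd r1 CC.
have Kr1 : d + pitch d < r - 1 by lra.
have := le_count_centres hd Kr1 dbl uS (fun c Cc cr => (SE c).2 (conj Cc cr)).
have -> : r - 1 - (d + pitch d) = r - (1 + (d + pitch d)) by ring.
move=> N.
have A : (\sum_(c <- S) area (open_disc c 1) <= area (covered r C))%E.
  have -> : area (covered r C) = (\sum_(i <- [:: tt]) area (covered r C))%E.
    by rewrite big_seq1.
  apply: (@sum_measure_le _ _ _ (lebesgue_measure \x lebesgue_measure)%E _ _
    S [:: tt] (fun c => open_disc c 1) (fun=> covered r C)) => [c|_|x].
  - exact: measurable_open_disc.
  - exact: measurable_covered CC.
  have [xA|xA] := boolP (x \in covered r C).
    rewrite -size_filter.
    have := filter_uniq (fun c => x \in open_disc c 1) uS.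
    have : {in [seq c <- S | x \in open_disc c 1],
        forall c, C c /\ open_disc c 1 x}.
      by move=> c; rewrite mem_filter => /andP[+ /SE[Cc _]]; rewrite inE.
    case: [seq _ <- _ | _] => [//|c1 [//|c2 S']] H.
    have [C1] := H c1 (mem_head _ _).
    have [|C2] := H c2; first by rewrite !inE eqxx orbT.
    rewrite /open_disc/= !edist_lt// => h2 h1.
    rewrite !inE !negb_or => /andP[/andP[c12 _] _].
    have := centre_set_dist d1 CC C1 C2 c12.
    have := sqr_ge0 ((x.1 - c1.1) + (x.1 - c2.1)).
    have := sqr_ge0 ((x.2 - c1.2) + (x.2 - c2.2)).
    lra.
  rewrite (eq_in_count (a2 := pred0)) ?count_pred0// => c /SE[Cc cr].
  apply/negbTE; apply: contra xA; rewrite !inE /open_disc/= => xc; split.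
    rewrite /disc/= -[r](subrKC 1).
    by apply: (@edist_triangle _ _ c) => //; exact: ltW.
  by exists c => //; exact: ltW.
apply: le_trans A; rewrite sum_area_open_discs lee_fin.
rewrite (_ : pi / _ * _ = pi * (2 * (pi * (r - (1 + (d + pitch d))) ^+ 2)
  / (2 * d * pitch d))).
  rewrite [leRHS]mulrC ler_pM2l ?pi_gt0// ler_pdivrMr// mulr_gt0// mulr_gt0//.
by field; rewrite !gt_eqF.
Qed.

(** * Packings of translates and their densities *)

Definition centres (R : realType) (d : R) (I : Type) (v : I -> R * R) : set (R * R) :=
  [set c | exists i (k : int), c = ((v i).1 + 2 * d * k%:~R, (v i).2)].

Lemma translate_stringE (R : realType) (d : R) (v p : R * R) :
  translate v (disc_string d) p <->
  exists k : int, disc (v.1 + 2 * d * k%:~R, v.2) 1 p.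
Proof.
have E (q : R * R) (k : int) : edist (q + v) (v.1 + 2 * d * k%:~R, v.2) =
    edist q (2 * d * k%:~R, 0).
  by rewrite /edist/=; congr (Num.sqrt (_ ^+ 2 + _ ^+ 2)); ring.
split=> [[q [_ [k _ <-]] qk <-]|[k pk]]; first by exists k; rewrite /disc/= E.
exists (p - v); last by rewrite subrK.
exists (2 * d * k%:~R, 0); first by exists k.
by rewrite /disc/= -E subrK.
Qed.

Lemma bigcup_translates (R : realType) (d : R) (I : Type) (v : I -> R * R) :
  \bigcup_i translate (v i) (disc_string d) = \bigcup_(c in centres d v) disc c 1.
Proof.
apply/seteqP; split=> [p [i _ /translate_stringE[k pk]]|p [_ [i [k ->]] pk]].
  by exists ((v i).1 + 2 * d * k%:~R, (v i).2) => //; exists i, k.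
by exists i => //; apply/translate_stringE; exists k.
Qed.

Lemma density_le (R : realType) (d : R) (I : Type) (F : I -> set (R * R))
    (C : set (R * R)) :
  Num.sqrt 3 < d < 2 -> centre_set d C ->
  \bigcup_i F i = \bigcup_(c in C) disc c 1 ->
  (upper_density F <= (pi / (d * pitch d))%:E)%E.
Proof.
move=> hd CC FC; apply/lee_addgt0Pr => e e0; apply: limf_esup_le.
near=> rho.
have rho0 : 0 < rho by near: rho; apply: nbhs_pinfty_gt; exact: num_real.
have prho : 0 < pi * rho ^+ 2 by rewrite mulr_gt0 ?pi_gt0 ?exprn_gt0.
rewrite FC -/(covered rho C) area_disc// inver gt_eqF// lee_pdivrMr//.
apply: (le_trans (area_covered_le hd (ltW rho0) CC)).
rewrite -EFinD -EFinM lee_fin.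
set K := 1 + _.
rewrite [leLHS](_ : _ = pi / (d * pitch d) * ((rho + K) / rho) ^+ 2 * (pi * rho ^+ 2)).
  rewrite ler_wpM2r// ?mulr_ge0 ?pi_ge0 ?sqr_ge0//.
  have /andP[] // : pi / (d * pitch d) - e <=
    pi / (d * pitch d) * ((rho + K) / rho) ^+ 2 <= pi / (d * pitch d) + e.
  by near: rho; exact: near_scale_sqr.
by move: (pi / _) => a; field; rewrite gt_eqF.
Unshelve. all: by end_near. Qed.

Lemma le_density (R : realType) (d : R) (I : Type) (F : I -> set (R * R))
    (C : set (R * R)) :
  Num.sqrt 3 < d < 2 -> centre_set d C ->
  (forall p, exists c c', [/\ C c, C c', c != c', cell d (pitch d) c p
     & cell d (pitch d) c' p]) ->
  \bigcup_i F i = \bigcup_(c in C) disc c 1 ->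
  ((pi / (d * pitch d))%:E <= upper_density F)%E.
Proof.
move=> hd CC dbl FC.
suff H e : 0 < e -> ((pi / (d * pitch d) - e)%:E <= upper_density F)%E.
  apply/lee_addgt0Pr => e e0.
  by rewrite -leeBlDr// -EFinB; exact: H.
move=> e0; apply: le_limf_esup.
near=> rho.
have rho0 : 0 < rho by near: rho; apply: nbhs_pinfty_gt; exact: num_real.
have prho : 0 < pi * rho ^+ 2 by rewrite mulr_gt0 ?pi_gt0 ?exprn_gt0.
rewrite FC -/(covered rho C) area_disc// inver gt_eqF// lee_pdivlMr//.
have Kr : 1 + (d + pitch d) < rho by near: rho; apply: nbhs_pinfty_gt; exact: num_real.
apply: (le_trans _ (le_area_covered hd Kr CC dbl)).
rewrite -EFinM lee_fin.
set K := 1 + _.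
rewrite [leRHS](_ : _ = pi / (d * pitch d) * ((rho - K) / rho) ^+ 2 * (pi * rho ^+ 2)).
  rewrite ler_wpM2r// ?mulr_ge0 ?pi_ge0 ?sqr_ge0//.
  have /andP[] // : pi / (d * pitch d) - e <=
    pi / (d * pitch d) * ((rho - K) / rho) ^+ 2 <= pi / (d * pitch d) + e.
  by near: rho; exact: near_scale_sqr.
by move: (pi / _) => a; field; rewrite gt_eqF.
Unshelve. all: by end_near. Qed.

Lemma open_open_disc (R : realType) (c : R * R) (r : R) : 0 < r ->
  open (open_disc c r).
Proof.
move=> r0.
pose f := fun p : R * R => (p.1 - c.1) ^+ 2 + (p.2 - c.2) ^+ 2.
rewrite (_ : open_disc c r = f @^-1` [set x | x < r ^+ 2]); last first.
  by apply/seteqP; split=> p; rewrite /open_disc/= edist_lt.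
apply: open_comp; last exact: open_lt.
move=> p _; apply: cvgD.
  apply: (@continuous_comp _ _ _ (fun p : R * R => p.1 - c.1) (fun x => x ^+ 2));
    last exact: exprn_continuous.
  by apply: cvgB; [exact: cvg_fst|exact: cvg_cst].
apply: (@continuous_comp _ _ _ (fun p : R * R => p.2 - c.2) (fun x => x ^+ 2));
  last exact: exprn_continuous.
by apply: cvgB; [exact: cvg_snd|exact: cvg_cst].
Qed.

(** If two circles of different strings were less than 2 apart, the midpoint of
their centres would be interior to both strings. *)
Lemma packing_centre_set (R : realType) (d : R) (I : Type) (v : I -> R * R) :
  trivIset [set: I] (fun i => interior (translate (v i) (disc_string d))) ->
  centre_set d (centres d v).
Proof.
move=> triv; split=> [_ [i [m ->]] k|_ _ [i [m ->]] [j [n ->]]].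
  by exists i, (m + k); rewrite /= intrD mulrDr addrA.
have [ij|ij] := pselect (i = j).
  by left; exists (n - m); rewrite ij/= intrB mulrBr; congr pair; ring.
right; rewrite leNgt; apply/negP => lt4; apply: ij; apply: triv => //.
pose c := ((v i).1 + 2 * d * m%:~R, (v i).2).
pose c' := ((v j).1 + 2 * d * n%:~R, (v j).2).
exists ((c.1 + c'.1) / 2, (c.2 + c'.2) / 2).
have sub k l : open_disc ((v k).1 + 2 * d * l%:~R, (v k).2) 1 `<=`
    interior (translate (v k) (disc_string d)).
  rewrite -open_subsetE; last exact: open_open_disc.
  by move=> p pk; apply/translate_stringE; exists l; exact: ltW.
split; [apply: (sub i m)|apply: (sub j n)]; rewrite /open_disc/= edist_lt//= expr1n.
- move: lt4 => /=; set x := 2 * d * _; set y := 2 * d * _; lra.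
- move: lt4 => /=; set x := 2 * d * _; set y := 2 * d * _; lra.
Qed.

(** A common interior point of two strings could be moved towards the centre of a
circle of the second string that contains it, and would stay in the first
string; then circles of the two strings would have centres less than 2 apart. *)
Lemma trivIset_interiors (R : realType) (d : R) (I : Type) (v : I -> R * R) :
  (forall i j, i <> j -> forall k l : int,
    4 <= ((v j).1 + 2 * d * l%:~R - ((v i).1 + 2 * d * k%:~R)) ^+ 2
         + ((v j).2 - (v i).2) ^+ 2) ->
  trivIset [set: I] (fun i => interior (translate (v i) (disc_string d))).
Proof.
move=> far i j _ _ [p [pFi pFj]]; apply: contrapT => ij.
have /translate_stringE[l] := interior_subset pFj.
set c := (_ + _, _) => pc.
have cv (a b : R) : a + t * b @[t --> (0 : R)^'+] --> a.
  rewrite -[X in _ --> X]addr0 -[X in _ --> _ + X](mul0r b).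
  apply: cvg_at_right_filter; apply: cvgD; first exact: cvg_cst.
  by apply: cvgM; [exact: cvg_id|exact: cvg_cst].
have cvp : (p.1 + t * (c.1 - p.1), p.2 + t * (c.2 - p.2)) @[t --> (0 : R)^'+]
    --> (p.1, p.2).
  exact: cvg_pair (cv p.1 _) (cv p.2 _).
rewrite -surjective_pairing in cvp.
near (0 : R)^'+ => t.
have t0 : 0 < t by near: t; exact: nbhs_right_gt.
have t1 : t < 1 by near: t; exact: nbhs_right_lt.
have /translate_stringE[k] : translate (v i) (disc_string d)
    (p.1 + t * (c.1 - p.1), p.2 + t * (c.2 - p.2)).
  by near: t; exact: (cvp _ pFi).
rewrite /disc/= !edist_le//= expr1n in pc *.
have := far _ _ ij k l.
move: ((v j).1 + _) ((v i).1 + _) pc => X x.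
move: (v j).2 (v i).2 => Y y pc uv.
(* By the parallelogram inequality the two centres, at distances at most 1 and
   less than 1 from the displaced point, are less than 2 apart. *)
have t2 : (1 - t) ^+ 2 * ((p.1 - X) ^+ 2 + (p.2 - Y) ^+ 2) < 1.
  apply: (@le_lt_trans _ _ ((1 - t) ^+ 2)); last by rewrite expr_lt1//; lra.
  by rewrite ler_piMr// sqr_ge0.
have := sqr_ge0 (p.1 + t * (X - p.1) - x + (1 - t) * (p.1 - X)).
have := sqr_ge0 (p.2 + t * (Y - p.2) - y + (1 - t) * (p.2 - Y)).
lra.
Unshelve. all: by end_near. Qed.

(** * The two-step packing *)

(** The multiple of [2 d] nearest to an offset in [[0, 2 d]] is one of the two ends
of the interval. *)
Lemma sqr_mod_ge (R : realType) (d x y : R) (k : int) :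
  0 <= x <= 2 * d -> 4 <= x ^+ 2 + y ^+ 2 -> 4 <= (2 * d - x) ^+ 2 + y ^+ 2 ->
  4 <= (x + 2 * d * k%:~R) ^+ 2 + y ^+ 2.
Proof.
move=> /andP[x0 xd] h1 h2.
have [k0|k0] := leP 0 k.
  have : 0 <= k%:~R :> R by rewrite ler0z.
  set u := k%:~R => u0.
  have : 0 <= 2 * d * u by rewrite mulr_ge0//; lra.
  nra.
have : k%:~R <= -1 :> R by rewrite -[-1]/((-1)%:~R) ler_int; lia.
set u := k%:~R => u0.
have : 0 <= 2 * d * (- 1 - u) by rewrite mulr_ge0//; lra.
nra.
Qed.

(** Horizontal displacement from the string of index [i] to that of index [i + 2],
up to reflection and periods. *)
Definition row_shift (R : realType) (d : R) : R := (3 * d + Num.sqrt 3 * gap d) / 2.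

Lemma pitch_bounds (R : realType) (d : R) : Num.sqrt 3 < d < 2 ->
  [/\ 3 / 2 <= pitch d, gap d < 1, 2 * pitch d - gap d = d * Num.sqrt 3,
      3 <= d * Num.sqrt 3 & Num.sqrt 3 * gap d < d].
Proof.
move=> hd; have [h0 s0 hd4 s3] := gapP hd; case/andP: hd => sd d2.
have ds : 3 <= d * Num.sqrt 3 by nra.
have h1 : gap d < 1 by nra.
split=> //.
- by rewrite /pitch; lra.
- by rewrite /pitch; lra.
- by nra.
Qed.

(** The vectors from [A1] to [C1] and from [B0] to [C1] have length 2. *)
Lemma triangle_norms (R : realType) (d : R) : Num.sqrt 3 < d < 2 ->
  ((d - Num.sqrt 3 * gap d) / 2) ^+ 2 + pitch d ^+ 2 = 4 /\
  ((d + Num.sqrt 3 * gap d) / 2) ^+ 2 + (pitch d - gap d) ^+ 2 = 4.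
Proof.
move=> hd; have [h0 s0 hd4 s3] := gapP hd; rewrite /pitch.
set s := Num.sqrt 3 in s3 *; set h := gap d in hd4 *.
have E : (1 + s ^+ 2) * (h ^+ 2 + d ^+ 2) / 4 = 4 by rewrite s3 hd4; lra.
by split; rewrite -[RHS]E; field.
Qed.

(** The vector between two strings is [e (d, h) + n (row_shift d, pitch d)] up to sign
and periods.  For [|n| >= 2] it is long because of its height; the cases left
are those of strings whose indices differ by at most 3. *)
Lemma row_dist (R : realType) (d : R) (e n k : int) :
  Num.sqrt 3 < d < 2 -> e = 0 \/ e = 1 -> (e, n) != (0, 0) ->
  4 <= (e%:~R * d + n%:~R * row_shift d + 2 * d * k%:~R) ^+ 2
       + (e%:~R * gap d + n%:~R * pitch d) ^+ 2.
Proof.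
move=> hd.
have [h0 s0 hd4 s3] := gapP hd.
have [H32 h1 Hh ds sh] := pitch_bounds hd.
have [T1 T2] := triangle_norms hd.
have far (x y : R) : 2 <= `|y| -> 4 <= x ^+ 2 + y ^+ 2.
  move=> y2; have := sqr_ge0 x; rewrite -(real_normK (num_real y)); nra.
have aE : 2 * d - row_shift d = (d - Num.sqrt 3 * gap d) / 2 by rewrite /row_shift; field.
have d0 : 0 < d by case/andP: hd => sd _; exact: lt_trans sd.
have sh0 : 0 < Num.sqrt 3 * gap d by exact: mulr_gt0.
have row1 m : 4 <= (row_shift d + 2 * d * m%:~R) ^+ 2 + pitch d ^+ 2.
  apply: sqr_mod_ge.
  - by rewrite /row_shift; lra.
  - have : 0 <= ((d - Num.sqrt 3 * gap d) / 2) <= row_shift d by rewrite /row_shift; lra.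
    nra.
  - by rewrite aE T1.
case=> -> en.
  rewrite !mul0r !add0r.
  have [n2|n2] := leP 2 `|n|.
    apply: far; rewrite normrM [`|pitch d|]gtr0_norm; last lra.
    have : 2 <= `|n%:~R| :> R by rewrite -intr_norm -[2]/(2%:~R) ler_int.
    by move=> ?; nra.
  have [->|->] : n = 1 \/ n = -1 by move: en n2; rewrite xpair_eqE eqxx/=; lia.
    by rewrite !mul1r.
  rewrite !mulN1r sqrrN -sqrrN opprD opprK.
  by have := row1 (- k); rewrite rmorphN/= mulrN.
rewrite !mul1r.
have [n2|n2] := leP 2 n.
  apply: far; rewrite ger0_norm.
    have : 2 <= n%:~R :> R by rewrite -[2]/(2%:~R) ler_int.
    by move=> ?; nra.
  have : 0 <= n%:~R :> R by rewrite ler0z; lia.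
  by move=> ?; nra.
have [n3|n3] := leP n (-2).
  apply: far; rewrite ler0_norm.
    have : n%:~R <= -2 :> R by rewrite -[-2]/((-2)%:~R) ler_int.
    by move=> ?; nra.
  have : n%:~R <= -2 :> R by rewrite -[-2]/((-2)%:~R) ler_int.
  by move=> ?; nra.
have [->|[->|->]] : n = 0 \/ n = 1 \/ n = -1 by lia.
- rewrite !mul0r !addr0; apply: sqr_mod_ge; first lra.
    by rewrite addrC hd4.
  by rewrite (_ : 2 * d - d = d); [rewrite addrC hd4|ring].
- rewrite !mul1r.
  have -> : d + row_shift d + 2 * d * k%:~R =
    (d + Num.sqrt 3 * gap d) / 2 + 2 * d * (k + 1)%:~R.
    by rewrite intrD /row_shift; field.
  have hH : (pitch d - gap d) ^+ 2 <= (gap d + pitch d) ^+ 2 by nra.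
  by apply: sqr_mod_ge; [lra|lra|nra].
rewrite !mulN1r -[(d - _ + _) ^+ 2]sqrrN -[(gap d - _) ^+ 2]sqrrN opprB.
have -> : - (d - row_shift d + 2 * d * k%:~R) =
    (d + Num.sqrt 3 * gap d) / 2 + 2 * d * (- k)%:~R.
  by rewrite rmorphN/= /row_shift; field.
by apply: sqr_mod_ge; [lra|lra|nra].
Qed.

(** The sign [sg] distinguishes the packing from its mirror image. *)
Lemma row_dist_signed (R : realType) (d : R) (sg e n k : int) :
  Num.sqrt 3 < d < 2 -> sg = 1 \/ sg = -1 -> [\/ e = 0, e = 1 | e = -1] ->
  (e, n) != (0, 0) ->
  4 <= (sg%:~R * (e%:~R * d + n%:~R * row_shift d) + 2 * d * k%:~R) ^+ 2
       + (e%:~R * gap d + n%:~R * pitch d) ^+ 2.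
Proof.
move=> hd sg1 e1 en.
wlog e01 : e n k e1 en / e = 0 \/ e = 1.
  move=> W; case: (e1) => E; [by apply: W => //; left|by apply: W => //; right|].
  have Ne : - e = 1 by rewrite E opprK.
  have Nen : (- e, - n) != (0, 0) by move: en; rewrite !xpair_eqE !oppr_eq0.
  have := W (- e) (- n) (- k) (Or32 _ _ Ne) Nen (or_intror Ne).
  rewrite !rmorphN/= => /le_trans; apply.
  by rewrite le_eqVlt; apply/predU1P; left; ring.
case: sg1 => ->; first by rewrite mul1r; exact: row_dist.
have := row_dist (- k) hd e01 en.
rewrite rmorphN/= rmorphN1 => /le_trans; apply.
by rewrite le_eqVlt; apply/predU1P; left; ring.
Qed.

(** The strings of even index, and those of odd index, are equally spaced, up to
horizontal periods. *)
Definition two_rows (R : realType) (d : R) (sg : int) (o : R * R)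
    (t : int -> R * R) : Prop :=
  forall m e : int, e = 0 \/ e = 1 -> exists k : int,
    t (2 * m + e) = (o.1 + sg%:~R * (e%:~R * d + m%:~R * row_shift d) + 2 * d * k%:~R,
                     o.2 + (e%:~R * gap d + m%:~R * pitch d)).

Lemma int_even_odd (i : int) : exists m e : int, (e = 0 \/ e = 1) /\ i = 2 * m + e.
Proof.
exists (i %/ 2)%Z, (i %% 2)%Z; split; last by rewrite mulrC -divz_eq.
have : 0 <= (i %% 2)%Z by exact: modz_ge0.
have : (i %% 2)%Z < 2 by exact: ltz_pmod.
by lia.
Qed.

Lemma two_rows_far (R : realType) (d : R) (sg : int) (o : R * R)
    (t : int -> R * R) :
  Num.sqrt 3 < d < 2 -> sg = 1 \/ sg = -1 -> two_rows d sg o t ->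
  forall i j, i <> j -> forall k l : int,
    4 <= ((t j).1 + 2 * d * l%:~R - ((t i).1 + 2 * d * k%:~R)) ^+ 2
         + ((t j).2 - (t i).2) ^+ 2.
Proof.
move=> hd sg1 tE i j ij k l.
have [m [e [e01 iE]]] := int_even_odd i.
have [n [f [f01 jE]]] := int_even_odd j.
have [k' tk] := tE m e e01; have [l' tl] := tE n f f01.
rewrite iE jE tk tl /=.
have fe : [\/ f - e = 0, f - e = 1 | f - e = -1].
  by case: e01 f01 => -> [->|->]; [apply: Or31|apply: Or32|apply: Or33|apply: Or31].
have en : (f - e, n - m) != (0, 0).
  by rewrite xpair_eqE; apply/negP => /andP[/eqP a /eqP b]; apply: ij; lia.
have := row_dist_signed (l' + l - k' - k) hd sg1 fe en.
rewrite !(intrD, rmorphN)/= => /le_trans; apply.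
by rewrite le_eqVlt; apply/predU1P; left; ring.
Qed.

(** One cell comes from the strings of even index and one from those of odd index;
their centres differ because [gap d] is not a multiple of [pitch d]. *)
Lemma two_rows_cover (R : realType) (d : R) (sg : int) (o : R * R)
    (t : int -> R * R) :
  Num.sqrt 3 < d < 2 -> two_rows d sg o t ->
  forall p, exists c c', [/\ centres d t c, centres d t c', c != c',
    cell d (pitch d) c p & cell d (pitch d) c' p].
Proof.
move=> hd tE p.
have H0 := pitch_gt0 hd.
have [h0 s0 hd4 s3] := gapP hd.
have [H32 h1 _ _ _] := pitch_bounds hd.
have d0 : 0 < d by case/andP: hd => sd _; exact: lt_trans sd.
have row e : e = 0 \/ e = 1 -> exists2 c, centres d t c /\ cell d (pitch d) c p &
    exists m : int, c.2 = o.2 + (e%:~R * gap d + m%:~R * pitch d).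
  move=> e01.
  set y := (p.2 - o.2 - e%:~R * gap d) / pitch d.
  have [k tk] := tE (Num.floor y) e e01.
  have [l] := reduce_mod (p.1 - (t (2 * Num.floor y + e)).1) d0.
  set x := (t _).1 => xl.
  exists (x + 2 * d * (- l)%:~R, (t (2 * Num.floor y + e)).2); last first.
    by exists (Num.floor y); rewrite tk.
  split; first by exists (2 * Num.floor y + e), (- l).
  split; rewrite /= in_itv/=; first by rewrite rmorphN/=; lra.
  have := floor_itv y; rewrite {2 3}/y ler_pdivlMr// ltr_pdivrMr// tk/= intrD.
  by lra.
have [c [cC pc] [m cE]] := row 0 (or_introl erefl).
have [c' [cC' pc'] [n cE']] := row 1 (or_intror erefl).
exists c, c'; split => //; apply/eqP => cc'.
move: cE; rewrite cc' cE' mul0r mul1r add0r => /addrI.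
have [mn|mn] := leP m n.
  have : m%:~R <= n%:~R :> R by rewrite ler_int.
  by set u := m%:~R; set v := n%:~R => uv E; nra.
have : n%:~R + 1 <= m%:~R :> R by rewrite -[1]/(1%:~R) -intrD ler_int; lia.
by set u := m%:~R; set v := n%:~R => uv E; nra.
Qed.

(** The highest points of a string lie exactly above its centres. *)
Lemma translate_string_inj (R : realType) (d : R) (u v : R * R) :
  translate u (disc_string d) = translate v (disc_string d) ->
  exists k : int, u = (v.1 + 2 * d * k%:~R, v.2).
Proof.
have top (a b : R * R) : translate a (disc_string d) = translate b (disc_string d) ->
    exists k : int,
      (a.1 - (b.1 + 2 * d * k%:~R)) ^+ 2 + (a.2 + 1 - b.2) ^+ 2 <= 1.
  move=> ab; have : translate a (disc_string d) (a.1, a.2 + 1).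
    apply/translate_stringE; exists 0; rewrite /disc/= edist_le//=.
    by rewrite mulr0 addr0 subrr addrAC subrr; lra.
  rewrite ab => /translate_stringE[k]; rewrite /disc/= edist_le//= expr1n.
  by exists k.
move=> uv; have [k ku] := top _ _ uv; have [l lv] := top _ _ (esym uv).
have e2 : u.2 = v.2.
  have := sqr_ge0 (u.1 - (v.1 + 2 * d * k%:~R)).
  have := sqr_ge0 (v.1 - (u.1 + 2 * d * l%:~R)).
  by move=> ? ?; apply/eqP; rewrite eq_le; apply/andP; split; nra.
exists k; rewrite [u]surjective_pairing e2; congr pair.
move: ku; rewrite e2 addrAC subrr add0r expr1n => ku.
have : (u.1 - (v.1 + 2 * d * k%:~R)) ^+ 2 == 0.
  by rewrite eq_le sqr_ge0 andbT; lra.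
by rewrite sqrf_eq0 subr_eq0 => /eqP.
Qed.

Lemma translateD (R : realType) (u v : R * R) (A : set (R * R)) :
  translate u (translate v A) = translate (v + u) A.
Proof.
apply/seteqP; split=> p [].
  by move=> _ [q Aq <-] <-; exists q => //; rewrite addrA.
by move=> q Aq <-; exists (q + v); [exists q|rewrite addrA].
Qed.

Lemma translate_centresE (R : realType) (d : R) (v c : R * R) :
  translate v (string_centres d) c <->
  exists k : int, c = (v.1 + 2 * d * k%:~R, v.2).
Proof.
split=> [[_ [k _ <-] <-]|[k ->]].
  by exists k; rewrite {1}[v]surjective_pairing; congr pair; rewrite /= ?add0r// addrC.
exists (2 * d * k%:~R, 0); first by exists k.
by rewrite {1}[v]surjective_pairing; congr pair; rewrite /= ?add0r// addrC.
Qed.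

Lemma edist_eq (R : realType) (p q : R * R) (r : R) : 0 <= r ->
  edist p q = r <-> (p.1 - q.1) ^+ 2 + (p.2 - q.2) ^+ 2 = r ^+ 2.
Proof.
move=> r0; split=> [<-|H]; last by rewrite /edist H sqrtr_sqr ger0_norm.
by rewrite sqr_sqrtr// addr_ge0// sqr_ge0.
Qed.

(** The points [A1], [B0] and [C1] form an equilateral triangle of side 2, and the
condition on heights selects one of the two possible positions of [C1].
Multiplying [p + i q] by [d + i h], of norm 2, makes the equations linear. *)
Lemma equilateral_apex (R : realType) (d p q : R) : Num.sqrt 3 < d < 2 ->
  p ^+ 2 + q ^+ 2 = 4 -> (p + d) ^+ 2 + (q - gap d) ^+ 2 = 4 -> gap d < q ->
  p = row_shift d - 2 * d /\ q = pitch d.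
Proof.
move=> hd; have [h0 s0 hd4 s3] := gapP hd.
have [H32 h1 Hh ds sh] := pitch_bounds hd.
have d0 : 0 < d by case/andP: hd => sd _; exact: lt_trans sd.
move=> pq1 pq2 hq.
have E1 : p * d - q * gap d = - 2 by nra.
have E2 : (p * gap d + q * d) ^+ 2 = (2 * Num.sqrt 3) ^+ 2.
  rewrite exprMn s3.
  have -> : (p * gap d + q * d) ^+ 2 =
    (p ^+ 2 + q ^+ 2) * (gap d ^+ 2 + d ^+ 2) - (p * d - q * gap d) ^+ 2 by ring.
  by rewrite E1 hd4 pq1; lra.
have qE : 4 * q = d * (p * gap d + q * d) - gap d * (p * d - q * gap d).
  by rewrite -hd4; ring.
have pE : 4 * p = d * (p * d - q * gap d) + gap d * (p * gap d + q * d).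
  by rewrite -hd4; ring.
move/eqP: E2; rewrite eqf_sqr => /orP[] /eqP E2; rewrite E1 E2 in qE pE.
  by split; rewrite /row_shift /pitch; lra.
by nra.
Qed.

(** The point [B0] lies halfway between [A0] and [A1], at height [h] above them, and
[C1] is the apex of an equilateral triangle on [A1] and [B0].  This gives the
strings of index 1 and 2; the others follow from the translation. *)
Lemma two_step_two_rows (R : realType) (d : R) (t : int -> R * R) :
  Num.sqrt 3 < d < 2 -> two_step_packing d t ->
  exists2 sg : int, sg = 1 \/ sg = -1 & two_rows d sg (t 0) t.
Proof.
move=> hd; have [h0 s0 hd4 s3] := gapP hd.
have d0 : 0 < d by case/andP: hd => sd _; exact: lt_trans sd.
case=> inc [A0 [A1 [B0 [C1 [[a0 a1 a01] [b0 a0b0 a1b0] [c1 a1c1 b0c1]]]]]] [w w02 wi].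
have {a0} [k0 A0E] := (translate_centresE _ _ _).1 a0.
have {a1} [k1 A1E] := (translate_centresE _ _ _).1 a1.
have {b0} [l B0E] := (translate_centresE _ _ _).1 b0.
have {c1} [m C1E] := (translate_centresE _ _ _).1 c1.
have d20 : 0 <= 2 * d by lra.
have two0 : 0 <= 2 :> R by [].
move: a01 => /(edist_eq _ _ d20).1; rewrite A0E A1E/= => a01.
move: a0b0 => /(edist_eq _ _ two0).1; rewrite A0E B0E/= => a0b0.
move: a1b0 => /(edist_eq _ _ two0).1; rewrite A1E B0E/= => a1b0.
move: a1c1 => /(edist_eq _ _ two0).1; rewrite A1E C1E/= => a1c1.
move: b0c1 => /(edist_eq _ _ two0).1; rewrite B0E C1E/= => b0c1.
have t01 := inc 0; have t12 := inc 1.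
rewrite add0r in t01; rewrite (_ : 1 + 1 = 2) // in t12.
have sg1 : k1 - k0 = 1 \/ k1 - k0 = -1.
  have : ((k1 - k0)%:~R : R) ^+ 2 = 1.
    apply: (@mulfI _ ((2 * d) ^+ 2)); first by rewrite expf_neq0 ?gt_eqF// mulr_gt0.
    by rewrite mulr1 -[RHS]a01 intrB; ring.
  move=> /eqP; rewrite sqrf_eq1 -[1]/(1%:~R) -rmorphN/= !eqr_int.
  by move=> /orP[] /eqP; [left|right].
exists (k1 - k0) => //; set sg := k1 - k0 in sg1 *.
have k1E : k1 = k0 + sg by rewrite /sg; ring.
have s2 : (sg%:~R : R) ^+ 2 = 1 by case: sg1 => ->; rewrite ?rmorphN1 ?sqrrN expr1n.
set S := (sg%:~R : R) in s2.
rewrite k1E intrD -/S in a01 a1b0 a1c1.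
have [t1x t1y] : (t 1).1 = (t 0).1 + S * d + 2 * d * (k0 - l)%:~R /\
    (t 1).2 = (t 0).2 + gap d.
  rewrite intrB; move: (k0%:~R) (l%:~R) a0b0 a1b0 => K L a0b0 a1b0.
  set X := (t 1).1 in a0b0 a1b0 *; set x := (t 0).1 in a0b0 a1b0 *.
  set Y := (t 1).2 in a0b0 a1b0 t01 *; set y := (t 0).2 in a0b0 a1b0 t01 *.
  pose u := X + 2 * d * L - (x + 2 * d * K).
  have uE : u = S * d.
    have : d * (S * u) = d * d by rewrite /u; nra.
    move/(mulfI (lt0r_neq0 d0)) => Su.
    by rewrite -[LHS]mul1r -s2 expr2 -mulrA Su.
  split; first by move: uE; rewrite /u; lra.
  have : (Y - y) ^+ 2 = gap d ^+ 2.
    have : u ^+ 2 = d ^+ 2 by rewrite uE exprMn s2 mul1r.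
    by rewrite /u; lra.
  move/eqP; rewrite eqf_sqr => /orP[] /eqP; lra.
have [t2x t2y] : (t 2).1 = (t 0).1 + S * row_shift d + 2 * d * (k0 - m)%:~R /\
    (t 2).2 = (t 0).2 + pitch d.
  move: b0c1 a1c1; rewrite t1x t1y !intrB.
  move: (k0%:~R) (l%:~R) (m%:~R) => K L M.
  move: t12; rewrite t1y.
  set X := (t 2).1; set x := (t 0).1; set Y := (t 2).2; set y := (t 0).2.
  move=> t12 b0c1 a1c1.
  pose P := S * (X + 2 * d * M - (x + 2 * d * (K + S))).
  have SP : S * P = X + 2 * d * M - (x + 2 * d * (K + S)).
    by rewrite /P mulrA -expr2 s2 mul1r.
  have e1 : P ^+ 2 + (Y - y) ^+ 2 = 4 by rewrite /P exprMn s2 mul1r; lra.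
  have e2 : (P + d) ^+ 2 + (Y - y - gap d) ^+ 2 = 4.
    have -> : (P + d) ^+ 2 = (S * P + S * d) ^+ 2.
      by rewrite -mulrDr exprMn s2 mul1r.
    by rewrite SP; lra.
  have e3 : gap d < Y - y by lra.
  have [PE qE] := equilateral_apex hd e1 e2 e3.
  split; last lra.
  by move: SP; rewrite PE; lra.
have step i : exists k : int,
    t (i + 2) = ((t i).1 + S * row_shift d + 2 * d * k%:~R, (t i).2 + pitch d).
  have := wi i; rewrite translateD => /translate_string_inj[k ti].
  move: w02; rewrite translateD => /translate_string_inj[k' t0w].
  exists (k0 - m + k' - k).
  rewrite [t (i + 2)]surjective_pairing.
  move: (congr1 fst ti) (congr1 snd ti) (congr1 fst t0w) (congr1 snd t0w) => /=.
  rewrite t2x t2y !(intrD, intrB, rmorphN)/= => f1 f2 f3 f4.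
  by congr pair; lra.
have base e : e = 0 \/ e = 1 -> exists k : int,
    t e = ((t 0).1 + S * (e%:~R * d) + 2 * d * k%:~R, (t 0).2 + e%:~R * gap d).
  case=> ->.
    by exists 0; rewrite !(mul0r, mulr0, addr0) -surjective_pairing.
  by exists (k0 - l); rewrite !mul1r [t 1]surjective_pairing t1x t1y.
have up (n : nat) i : exists k : int, t (i + 2 * n%:Z) =
    ((t i).1 + S * (n%:R * row_shift d) + 2 * d * k%:~R, (t i).2 + n%:R * pitch d).
  elim: n => [|n [k IH]].
    by exists 0; rewrite !(mul0r, mulr0, addr0) -surjective_pairing.
  have [k' E] := step (i + 2 * n%:Z).
  exists (k + k'); rewrite (_ : i + 2 * n.+1%:Z = i + 2 * n%:Z + 2); last by lia.
  by rewrite E IH/= -natr1 intrD; congr pair; ring.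
move=> n e e01; have [k0' be] := base e e01.
case: n => n.
  have [k E] := up n e; exists (k0' + k).
  by rewrite addrC E be/= intrD; congr pair; ring.
have [k E] := up n.+1 (2 * Negz n + e).
exists (k0' - k).
move: E; rewrite (_ : 2 * Negz n + e + 2 * n.+1%:Z = e); last by lia.
rewrite be [t (2 * _ + e)]surjective_pairing NegzE => -[f1 f2].
rewrite rmorphN/= intrB in f1 f2 *.
by congr pair; lra.
Qed.

Lemma two_step_exists (R : realType) (d : R) : Num.sqrt 3 < d < 2 ->
  exists t : int -> R * R, two_step_packing d t.
Proof.
move=> hd; have [h0 s0 hd4 s3] := gapP hd.
have [H32 h1 _ _ _] := pitch_bounds hd.
have [T1 T2] := triangle_norms hd.
have d0 : 0 < d by case/andP: hd => sd _; exact: lt_trans sd.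
pose t (i : int) : R * R :=
  ((i %% 2)%Z%:~R * d + (i %/ 2)%Z%:~R * row_shift d,
   (i %% 2)%Z%:~R * gap d + (i %/ 2)%Z%:~R * pitch d).
have tE (m e : int) : e = 0 \/ e = 1 ->
    t (2 * m + e) = (e%:~R * d + m%:~R * row_shift d, e%:~R * gap d + m%:~R * pitch d).
  move=> e01; have e2 : (e %/ 2)%Z = 0 /\ (e %% 2)%Z = e by case: e01 => ->.
  by rewrite /t [2 * m]mulrC divzMDl// modzMDl e2.1 e2.2 addr0.
have t2 i : t (i + 2) = t i + (row_shift d, pitch d).
  have [m [e [e01 ->]]] := int_even_odd i.
  rewrite (_ : 2 * m + e + 2 = 2 * (m + 1) + e); last by ring.
  by rewrite !tE// intrD; congr pair; rewrite /=; ring.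
have t0E : t 0 = 0 by rewrite (tE 0 0 (or_introl erefl)) !mul0r addr0.
have t1E : t 1 = (d, gap d).
  by rewrite (tE 0 1 (or_intror erefl)) !mul0r !mul1r !addr0.
have t2E : t 2 = (row_shift d, pitch d) by rewrite (t2 0) t0E add0r.
exists t; split.
- move=> i; have [m [e [[->|->] ->]]] := int_even_odd i.
    rewrite (_ : 2 * m + 0 + 1 = 2 * m + 1); last by ring.
    by rewrite (tE m 0 (or_introl erefl)) (tE m 1 (or_intror erefl))/=; lra.
  rewrite (_ : 2 * m + 1 + 1 = 2 * (m + 1) + 0); last by ring.
  rewrite (tE m 1 (or_intror erefl)) (tE (m + 1) 0 (or_introl erefl))/= intrD.
  by lra.
- exists 0, (2 * d, 0), (d, gap d), (row_shift d, pitch d).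
  have two0 : 0 <= 2 :> R by [].
  have ctr (v : R * R) : translate v (string_centres d) v.
    apply/translate_centresE; exists 0.
    by rewrite mulr0 addr0 -surjective_pairing.
  split; split.
  + by rewrite t0E.
  + by apply/translate_centresE; exists 1; rewrite t0E/= mulr1 add0r.
  + by apply/edist_eq; rewrite ?mulr_ge0 ?(ltW d0)//=; ring.
  + by rewrite t1E.
  + by apply/edist_eq => //=; lra.
  + by apply/edist_eq => //=; lra.
  + by rewrite t2E.
  + by apply/edist_eq => //=; rewrite /row_shift; lra.
  + apply/edist_eq => //=; rewrite /row_shift; lra.
- have wE i : translate (row_shift d, pitch d) (translate (t i) (disc_string d)) =
      translate (t (i + 2)) (disc_string d) by rewrite translateD t2.
  by exists (row_shift d, pitch d); [exact: (wE 0)|exact: wE].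
Qed.

Lemma packing_density_le (R : realType) (d : R) (I : Type) (F : I -> set (R * R)) :
  Num.sqrt 3 < d < 2 -> translate_packing (disc_string d) F ->
  (upper_density F <= (pi / (d * pitch d))%:E)%E.
Proof.
move=> hd [/choice[v vE] triv].
have FE : F = fun i => translate (v i) (disc_string d) by apply/funext.
rewrite FE in triv *; apply: (density_le hd (packing_centre_set triv)).
exact: bigcup_translates.
Qed.

Theorem mainTheorem1 (R : realType) (d : R)
    (hd : Num.sqrt 3 < d < 2) :
  let D : \bar R :=
    (2 * pi / (d * (Num.sqrt (4 - d ^+ 2) + d * Num.sqrt 3)))%:E in
  [/\ forall (I : Type) (F : I -> set (R * R)),
        translate_packing (disc_string d) F -> (upper_density F <= D)%E,
      exists t : int -> R * R, two_step_packing d t &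
      forall t : int -> R * R, two_step_packing d t ->
        let L := fun i : int => translate (t i) (disc_string d) in
        translate_packing (disc_string d) L /\ upper_density L = D].
Proof.
move=> D.
have -> : D = (pi / (d * pitch d))%:E.
  have [h0 s0 _ _] := gapP hd.
  have d0 : 0 < d by case/andP: hd => sd _; exact: lt_trans sd.
  rewrite /D /pitch -/(gap d); congr (_%:E); field.
  by rewrite !gt_eqF// addr_gt0// mulr_gt0.
split=> [I F|| t tP L]; first exact: packing_density_le.
  exact: two_step_exists.
have [sg sg1 rows] := two_step_two_rows hd tP.
have LP : translate_packing (disc_string d) L.
  split=> [i|]; first by exists (t i).
  exact: trivIset_interiors (two_rows_far hd sg1 rows).
split=> //; apply/eqP; rewrite eq_le packing_density_le//=.
apply: (le_density hd (packing_centre_set LP.2) (two_rows_cover hd rows)).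
exact: bigcup_translates.
Qed.
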